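(* Let $N\ge 1$ and let $\mathbf w^{\mathrm{start}}=(w_1^{\mathrm{start}},\dots,w_N^{\mathrm{start}})$ and $\mathbf w^{\mathrm{end}}=(w_1^{\mathrm{end}},\dots,w_N^{\mathrm{end}})$ be weight vectors, i.e. all $w_i^{\mathrm{start}}>0$, $w_i^{\mathrm{end}}>0$, and $\sum_i w_i^{\mathrm{start}}=\sum_i w_i^{\mathrm{end}}=1$. Let $$r=\prod_{j=1}^N\left(\frac{w_j^{\mathrm{start}}}{w_j^{\mathrm{end}}}\right)^{w_j^{\mathrm{end}}}$$ be the retention ratio of the weight update $\mathbf w^{\mathrm{start}}\to\mathbf w^{\mathrm{end}}$. Then $$-\log r=\sum_{i=1}^N w_i^{\mathrm{end}}\log\frac{w_i^{\mathrm{end}}}{w_i^{\mathrm{start}}}=D_{\mathrm{KL}}\left(\mathbf w^{\mathrm{end}}\,\|\,\mathbf w^{\mathrm{start}}\right).$$ In particular $r\le 1$, with equality if and only if $\mathbf w^{\mathrm{end}}=\mathbf w^{\mathrm{start}}$.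
   Context: $D_{\mathrm{KL}}(p\,\|\,q)=\sum_i p_i\log(p_i/q_i)$ is the Kullback--Leibler divergence of two positive probability vectors. Interpretation: $r$ is the ratio of final to initial value of an $N$-asset geometric mean market maker pool (zero fees, perfect arbitrage, constant market prices) whose weights are changed from $\mathbf w^{\mathrm{start}}$ to $\mathbf w^{\mathrm{end}}$; $-\log r$ is the log-loss of the update. *)

(* Defs.v *)
From HB Require Import structures.
From mathcomp Require Import all_boot all_order all_algebra.
From mathcomp Require Import reals exp.

Set Implicit Arguments.
Unset Strict Implicit.
Unset Printing Implicit Defensive.

Import Order.TTheory GRing.Theory Num.Theory.
Local Open Scope ring_scope.

Definition weight_vector (R : realType) (N : nat) (w : 'rV[R]_N) : Prop :=
  (forall i : 'I_N, 0 < w ord0 i) /\ \sum_(i < N) w ord0 i = 1.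

(* [a `^ x] is the real power [powR], equal to [expR (x * ln a)] for a > 0. *)
Definition retention_ratio (R : realType) (N : nat)
    (wstart wend : 'rV[R]_N) : R :=
  \prod_(j < N) (wstart ord0 j / wend ord0 j) `^ (wend ord0 j).

(* Meant for positive p and q only: [ln] and division are totalized, so zero
   entries would not follow the usual +oo convention. *)
Definition KL_divergence (R : realType) (N : nat) (p q : 'rV[R]_N) : R :=
  \sum_(i < N) p ord0 i * ln (p ord0 i / q ord0 i).

(* Main.v *)
(* The log of r is the wend-average of ln (wstart_i / wend_i), so r <= 1 with its
   equality case is Gibbs' inequality: the tangent-line bound ln x <= x - 1
   (strict for x != 1), applied to x = wstart_i / wend_i and averaged, sums to
   0 because both weight vectors have total mass 1. *)
Require Import Defs.
From HB Require Import structures.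
From mathcomp Require Import all_boot all_order all_algebra.
From mathcomp Require Import reals exp.
From mathcomp Require Import sequences ring.

Set Implicit Arguments.
Unset Strict Implicit.
Unset Printing Implicit Defensive.

Import Order.TTheory GRing.Theory Num.Theory.
Local Open Scope ring_scope.

(** With [y = ln x] this is [1 + y < expR y], strict because [x != 1] forces [y != 0]. *)
Lemma ln_lt_subr1 (R : realType) (x : R) : 0 < x -> x != 1 -> ln x < x - 1.
Proof.
move=> x0 x1; have lnx0 : ln x != 0 by rewrite ln_eq0.
by rewrite ltrBrDl -[ltRHS]lnK// expR_gt1Dx.
Qed.

(** The tangent-line bound at [q / p], scaled by [p]. The [leif] form carries the equality case
    through the later summation. *)
Lemma mulr_ln_div_leif (R : realType) (p q : R) : 0 < p -> 0 < q ->
  p * ln (q / p) <= q - p ?= iff (q == p).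
Proof.
move=> p0 q0; have pn0 : p != 0 by rewrite gt_eqF.
have [->|qp] := eqVneq q p.
  by rewrite divff// ln1 mulr0 subrr; exact: leif_refl.
have lt_qp : p * ln (q / p) < q - p.
  have -> : q - p = p * (q / p - 1) by field.
  rewrite ltr_pM2l// ln_lt_subr1 ?divr_gt0//.
  by rewrite -subr_eq0 -[X in _ - X](divff pn0) -mulrBl mulf_neq0 ?subr_eq0 ?invr_eq0.
by split; [exact: ltW | rewrite (lt_eqF lt_qp)].
Qed.

Lemma retention_ratioE (R : realType) (N : nat) (p q : 'rV[R]_N) :
  (forall i, 0 < p ord0 i) -> (forall i, 0 < q ord0 i) ->
  retention_ratio q p = expR (\sum_(i < N) p ord0 i * ln (q ord0 i / p ord0 i)).
Proof.
move=> p0 q0; rewrite expR_sum; apply: eq_bigr => i _.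
(* [powR] treats base 0 separately; positivity of the ratio selects the exponential branch. *)
by rewrite /powR gt_eqF ?divr_gt0.
Qed.

(** A sum of termwise bounds is tight exactly when every term is tight, which here means that the
    two rows agree entrywise. *)
Lemma gibbs_leif (R : realType) (N : nat) (p q : 'rV[R]_N) :
  weight_vector p -> weight_vector q ->
  \sum_(i < N) p ord0 i * ln (q ord0 i / p ord0 i) <= 0 ?= iff (p == q).
Proof.
move=> [p0 p1] [q0 q1].
have := @leif_sum R 'I_N xpredT (fun i => q ord0 i == p ord0 i) _ _
  (fun i _ => mulr_ln_div_leif (p0 i) (q0 i)).
rewrite sumrB p1 q1 subrr; congr (_ <= _ ?= iff _).
apply/forallP/eqP => [eq_qp|-> i]; last exact/eqP.
by apply/rowP => i; exact/esym/eqP/eq_qp.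
Qed.

Theorem theorem1 (R : realType) (N : nat) (hN : (1 <= N)%N)
    (wstart wend : 'rV[R]_N)
    (hstart : weight_vector wstart) (hend : weight_vector wend) :
  let r := retention_ratio wstart wend in
  [/\ - ln r = \sum_(i < N) wend ord0 i * ln (wend ord0 i / wstart ord0 i),
      \sum_(i < N) wend ord0 i * ln (wend ord0 i / wstart ord0 i)
        = KL_divergence wend wstart,
      r <= 1
    & r = 1 <-> wend = wstart].
Proof.
have [[s0 _] [e0 _]] := (hstart, hend).
have [sum_le0 sum_eq0] := gibbs_leif hend hstart.
move=> r; rewrite {}/r retention_ratioE//; split => //.
- rewrite expRK -sumrN; apply: eq_bigr => i _.
  (* The minus sign moves into the logarithm and inverts the ratio. *)
  by rewrite -mulrN -lnV ?posrE ?divr_gt0// invf_div.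
- by rewrite expR_le1.
(* Since [expR] is injective, [r = 1 = expR 0] exactly when the exponent vanishes. *)
- split=> [/eqP|/eqP]; last by rewrite -sum_eq0 => /eqP ->; rewrite expR0.
  by rewrite -expR0 (inj_eq (@expR_inj R)) sum_eq0 => /eqP.
Qed.
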